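(* Let $T$ be a finite rooted tree with root $r$ and binary diagonal labeling $\varepsilon:V(T)\to\mathbb F_2$. Then there is an integer $k\ge 0$ and a nonempty affine subspace $L_T\subseteq\mathbb F_2^2$ such that \[ N_T(\alpha,\beta)=\begin{cases}2^k, & (\alpha,\beta)\in L_T,\\ 0, & (\alpha,\beta)\notin L_T.\end{cases} \] Moreover, the pair $(L_T,k)$ is obtained recursively from the corresponding pairs of the child subtrees, as follows. Let $T_1,\ldots,T_m$ be the child subtrees of the root, rooted at the children $r_1,\ldots,r_m$ of $r$ and labeled by the restrictions of $\varepsilon$, and suppose that \[ N_{T_i}(\alpha,\beta)=2^{k_i}\,\mathbf 1_{L_i}(\alpha,\beta)\qquad(1\le i\le m), \] where $L_i\subseteq\mathbb F_2^2$ is an affine subspace and $k_i\geq 0$ is an integer. Then $L_T$ is the set of all pairs $(\alpha,\beta)\in\mathbb F_2^2$ for which there exist $\gamma_1,\ldots,\gamma_m\in\mathbb F_2$ such that \[ (\beta,\gamma_i)\in L_i\quad(1\le i\le m)\qquad\text{and}\qquad \sum_{i=1}^m\gamma_i+\varepsilon(r)\beta=\varepsilon(r)+\alpha . \] For each $(\alpha,\beta)\in L_T$, the number of such tuples $(\gamma_1,\ldots,\gamma_m)$ is independent of $(\alpha,\beta)$; if this number is $2^s$, then \[ k=\sum_{i=1}^m k_i+s . \]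
   Context: All matrices and vector spaces are over the two-element field $\mathbb F_2$. For a rooted tree $T$ with root $r$ and labeling $\varepsilon:V(T)\to\mathbb F_2$ (also viewed as a vector in $\mathbb F_2^{V(T)}$), put $M(T,\varepsilon)=A(T)+D_\varepsilon$, where $A(T)$ is the adjacency matrix of $T$ over $\mathbb F_2$ and $D_\varepsilon$ is the diagonal matrix with diagonal vector $\varepsilon$. Let $e_r$ be the standard basis vector at $r$. For $\alpha,\beta\in\mathbb F_2$ define \[ N_T(\alpha,\beta)=\#\{x\in\mathbb F_2^{V(T)} : M(T,\varepsilon)x=\varepsilon+\alpha e_r,\ x_r=\beta\}. \] $\mathbf 1_L$ denotes the indicator function of a subset $L\subseteq\mathbb F_2^2$. The child subtree at a child $r_i$ of the root is the rooted subtree consisting of $r_i$ and all its descendants, with root $r_i$; $N_{T_i}$ is defined in the same way using $T_i$, $r_i$ and the restricted labeling. *)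

(* Defs.v *)
From mathcomp Require Import all_boot all_order all_algebra.
Set Implicit Arguments.
Unset Strict Implicit.
Unset Printing Implicit Defensive.

Import GRing.Theory.
Local Open Scope ring_scope.

Record rootedTree := RootedTree {
  vertex :> finType;
  adj : rel vertex;
  tree_root : vertex;
  adj_sym : symmetric adj;
  adj_irr : irreflexive adj;
  adj_connected : forall x y, connect adj x y;
  (* [:: x; y] is a ucycle for every edge xy, hence the bound 2. *)
  adj_acyclic : forall c, ucycle adj c -> (size c <= 2)%N
}.

Arguments adj {r}.

Section Subtree.
Variables (T : rootedTree) (c : T).

(* v is c or a descendant of c: a simple path from the root to v visits c.
   A simple path has at most #|T| vertices, so bounding its length loses
   nothing and makes the predicate decidable. *)
Definition descendant : pred T := fun v =>
  [exists p : #|T|.-bseq T,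
    [&& path adj (tree_root T) p, uniq (tree_root T :: p), last (tree_root T) p == v
      & c \in tree_root T :: p]].

Lemma descendantP v :
  reflect (exists p : seq T, [/\ path adj (tree_root T) p, uniq (tree_root T :: p),
                                 last (tree_root T) p = v & c \in tree_root T :: p])
          (descendant v).
Proof.
apply: (iffP existsP) => [[p /and4P[pp up /eqP lp cp]]|[p [pp up lp cp]]].
  by exists p.
have sp : (size p <= #|T|)%N.
  rewrite -(card_uniqP _) ?max_card //.
  by case/andP: up.
by exists (Bseq sp); rewrite /= lp eqxx cp pp; move: up => /= ->.
Qed.

Lemma descendant_self : descendant c.
Proof.
have /connectP[p pp lp] := adj_connected (tree_root T) c.
case/shortenP: pp lp => q pq uq _ lq.
by apply/descendantP; exists q; split=> //; rewrite lq mem_last.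
Qed.

Definition subtree_vertex := {v : T | descendant v}.
Definition subtree_adj : rel subtree_vertex := fun x y => adj (val x) (val y).
Definition subtree_root : subtree_vertex := Sub c descendant_self.

Lemma subtree_sym : symmetric subtree_adj.
Proof. by move=> x y; apply: adj_sym. Qed.

Lemma subtree_irr : irreflexive subtree_adj.
Proof. by move=> x; apply: adj_irr. Qed.

Lemma subtree_root_connected v : connect subtree_adj subtree_root v.
Proof.
case: v => v dv; case/descendantP: (dv) => p [].
elim/last_ind: p v dv => [|p w IH] v dv.
  move=> _ _ /= rv; rewrite inE => /eqP cr.
  by rewrite (_ : exist _ _ _ = subtree_root) //; apply: val_inj; rewrite /= cr.
rewrite rcons_path last_rcons -rcons_cons rcons_uniq mem_rcons inE.
move=> /andP[pp aw] /andP[_ up] wv.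
have [cw _|cw /= cp] := eqVneq c w.
  by rewrite (_ : exist _ _ _ = subtree_root) //; apply: val_inj; rewrite /= cw wv.
have dl : descendant (last (tree_root T) p) by apply/descendantP; exists p.
apply: connect_trans (IH _ dl pp up erefl cp) _.
by apply: connect1; rewrite /subtree_adj /= -wv.
Qed.

Lemma subtree_connected x y : connect subtree_adj x y.
Proof.
apply: connect_trans (subtree_root_connected y).
rewrite (_ : connect _ x _ = connect subtree_adj subtree_root x); first exact: subtree_root_connected.
exact: (sym_connect_sym subtree_sym).
Qed.

Lemma subtree_acyclic s : ucycle subtree_adj s -> (size s <= 2)%N.
Proof.
case/andP=> cs us; rewrite -(size_map val); apply: adj_acyclic.
rewrite /ucycle map_inj_uniq ?us ?andbT; last exact: val_inj.
by case: s cs us => //= x s; rewrite -map_rcons path_map.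
Qed.

Definition subtree : rootedTree :=
  RootedTree subtree_root subtree_sym subtree_irr subtree_connected
    subtree_acyclic.

Definition restrict (eps : T -> 'F_2) : subtree -> 'F_2 :=
  fun v => eps (val v).

End Subtree.

Section Counting.
Variables (T : rootedTree) (eps : T -> 'F_2).

(* Coordinates of F_2^V are indexed by 'I_#|T| through enum_val/enum_rank. *)
Definition label_vec : 'cV['F_2]_#|T| := \col_i eps (enum_val i).

Definition adj_mx : 'M['F_2]_#|T| :=
  \matrix_(i, j) (adj (enum_val i) (enum_val j))%:R.

Definition tree_mx : 'M['F_2]_#|T| := adj_mx + diag_mx label_vec^T.

Definition root_vec : 'cV['F_2]_#|T| := delta_mx (enum_rank (tree_root T)) 0.

Definition Ncount (alpha beta : 'F_2) : nat :=
  #|[set x : 'cV['F_2]_#|T| |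
      (tree_mx *m x == label_vec + alpha *: root_vec)
      && (x (enum_rank (tree_root T)) 0 == beta)]|.

End Counting.

(* Convention: the empty set is an affine subspace; nonemptiness is stated
   separately where it is meant.  ('F_2)^o is 'F_2 as a vector space over
   itself. *)
Definition is_affine (L : {set 'F_2 * 'F_2}) : Prop :=
  L = set0 \/
  exists (p : 'F_2 * 'F_2) (U : {vspace ('F_2)^o * ('F_2)^o}),
    L = [set q : 'F_2 * 'F_2 | q - p \in U].

(* The tuples (gamma_1, ..., gamma_m) that extend (alpha, beta), where a is the
   label of the root and Ls i is the subset of F_2^2 attached to the i-th
   child. *)
Definition extensions (m : nat) (Ls : 'I_m -> {set 'F_2 * 'F_2}) (a : 'F_2)
    (alpha beta : 'F_2) : {set {ffun 'I_m -> 'F_2}} :=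
  [set g : {ffun 'I_m -> 'F_2} |
    [forall i, (beta, g i) \in Ls i]
    && (\sum_(i < m) g i + a * beta == a + alpha)].

(* Main.v *)
(* Since A is symmetric over F_2, any y with M y = 0 satisfies
   0 = y^T M y = y^T eps, so eps lies in the column space of M and L_T is
   nonempty.  L_T is the image of the affine space {(x, alpha) : M x = eps + alpha e_r}
   under (x, alpha) |-> (alpha, x_r), and the nonempty fibres of this map are
   cosets of {x : M x = 0, x_r = 0}, which gives the common size 2^k.

   Deleting the root splits the system M x = eps + alpha e_r: x solves it with
   x_r = beta exactly when each restriction x_i to a child subtree solves
   M_i x_i = eps_i + beta e_{r_i} and the root row holds.  So N_T(alpha, beta) is the
   sum over tuples gamma satisfying the root row of the products of the
   N_{T_i}(beta, gamma_i), that is 2^(sum k_i) times the number of extensions. *)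
From HB Require Import structures.
Require Import Defs.
From mathcomp Require Import all_boot all_order all_algebra all_field.
Import GRing.Theory.
Local Open Scope ring_scope.
Set Implicit Arguments.
Unset Strict Implicit.
Unset Printing Implicit Defensive.

(** * Symmetric matrices over the two-element field *)

Lemma addFF2 (a : 'F_2) : a + a = 0.
Proof. by rewrite -mulr2n -mulr_natl (@pchar_Zp 2) ?mul0r. Qed.

Lemma mulFF2 (a : 'F_2) : a * a = a.
Proof. by case: a => [[|[|[]]]] //= i; apply: val_inj. Qed.

(** The terms at [(i, j)] and [(j, i)] are equal, so off the diagonal they cancel in pairs in
    characteristic 2. *)
Lemma sum_sym_F2 n (f : 'I_n -> 'I_n -> 'F_2) :
  (forall i j, f i j = f j i) -> \sum_i \sum_j f i j = \sum_i f i i.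
Proof.
move=> fC; transitivity (\sum_i (f i i + \sum_(j < n | (i < j)%N) f i j
    + \sum_(j < n | (j < i)%N) f i j)).
  apply: eq_bigr => i _; rewrite (bigD1 i) //= -addrA; congr (_ + _).
  rewrite (bigID (fun j : 'I_n => (i < j)%N)) /=.
  by congr (_ + _); apply: eq_bigl => j /=; rewrite -val_eqE /=; case: ltngtP.
rewrite !big_split /= -addrA [X in _ + (_ + X)](exchange_big_dep xpredT) //=.
under [X in _ + (_ + X)]eq_bigr do under eq_bigr do rewrite fC.
by rewrite addFF2 addr0.
Qed.

(** The column space is tested against the kernel: for [M y = 0], the form [y^T M y] vanishes and
    collapses to the pairing of [y] with the diagonal, because squaring is the identity on
    ['F_2]. *)
Lemma sym_diag_solvable_F2 n (M : 'M['F_2]_n) :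
  M^T = M -> exists x : 'cV_n, M *m x = \col_i M i i.
Proof.
move=> MT; suff /submxP[D dD] : ((\col_i M i i)^T <= M)%MS.
  by exists D^T; rewrite -[M in LHS]MT -trmx_mul -dD trmxK.
rewrite submxE; apply/eqP/matrixP=> i j; rewrite !mxE.
(* A row lies in the row space of [M] iff the cokernel matrix kills it, so the columns of
   [cokermx M] serve as the kernel vectors. *)
pose y : 'cV_n := col j (cokermx M).
have My : M *m y = 0 by rewrite /y colE mulmxA mulmx_coker mul0mx.
have : \sum_i \sum_k y i 0 * M i k * y k 0 = 0.
  apply: big1 => k _.
  have /matrixP/(_ k 0) := My; rewrite !mxE => e.
  by under eq_bigr do rewrite -mulrA; rewrite -mulr_sumr e mulr0.
rewrite sum_sym_F2 => [e|k l]; last first.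
  have -> : M k l = M l k by rewrite -[in LHS]MT mxE.
  by rewrite mulrC [X in _ * X]mulrC mulrA.
rewrite -[RHS]e; apply: eq_bigr => k _.
by rewrite mulrAC mulFF2 mulrC !mxE.
Qed.

(** * Affine structure of the root data of solutions *)

Section AffineCount.
Variables (T : rootedTree) (eps : T -> 'F_2).
Let M := tree_mx eps.
Let r : 'I_#|T| := enum_rank (tree_root T).
Let e := root_vec T.

Lemma tree_mx_sym : M^T = M.
Proof.
rewrite /M /tree_mx linearD /= tr_diag_mx; congr (_ + _).
by apply/matrixP => i j; rewrite !mxE adj_sym.
Qed.

Lemma tree_mx_diag : \col_i M i i = label_vec eps.
Proof.
by apply/matrixP => i j; rewrite !mxE adj_irr eqxx add0r.
Qed.

Lemma label_vec_solvable : exists x, M *m x = label_vec eps.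
Proof. by rewrite -tree_mx_diag; apply/sym_diag_solvable_F2/tree_mx_sym. Qed.

(** The common direction space of all nonempty solution sets with prescribed [alpha] and [beta]. *)
Definition hom_sols : {set 'cV['F_2]_#|T|} :=
  [set x | (M *m x == 0) && (x r 0 == 0)].

Lemma card_hom_sols : exists k, #|hom_sols| = (2 ^ k)%N.
Proof.
(* Stacking both conditions into one linear map makes [hom_sols] a kernel, whose dimension is the
   exponent. *)
pose phi (x : 'cV['F_2]_#|T|) := col_mx (M *m x) (x r 0)%:M : 'cV_(#|T| + 1).
have phiL : linear phi.
  move=> a x y; rewrite /phi mulmxDr -scalemxAr !mxE raddfD /=.
  by rewrite scale_col_mx add_col_mx scale_scalar_mx.
pose phiM := GRing.isLinear.Build _ _ _ _ phi phiL.
pose phiF : {linear _ -> _} := HB.pack phi phiM.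
exists (\dim (lker (linfun phiF))).
rewrite -[X in (X ^ _)%N](@card_Fp 2) // -card_vspace.
apply: eq_card => x; rewrite inE memv_ker lfunE /=.
have -> : (phi x == 0) = (phi x == col_mx 0 0) by rewrite col_mx0.
rewrite col_mx0 col_mx_eq0; congr (_ && _).
by apply/eqP/eqP=> [->|/matrixP/(_ 0 0)]; rewrite ?raddf0 // !mxE.
Qed.


(** Adding the particular solution [x] maps [hom_sols] bijectively onto the solution set. *)
Lemma Ncount_translate alpha beta x :
  x \in [set x | (M *m x == label_vec eps + alpha *: e) && (x r 0 == beta)] ->
  Ncount eps alpha beta = #|hom_sols|.
Proof.
rewrite inE => /andP[/eqP Mx /eqP xr].
rewrite -(card_imset _ (addrI x)); apply: eq_card => y; rewrite inE.
rewrite -[y](subrK x) [y - x + x]addrC mem_imset ?inE; last exact: addrI.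
rewrite mulmxDr mxE Mx xr -subr_eq0 addrAC subrr add0r; congr (_ && _).
by rewrite -subr_eq0 addrAC subrr add0r.
Qed.

Lemma Ncount_supportP alpha beta :
  reflect (exists x, M *m x = label_vec eps + alpha *: e /\ x r 0 = beta)
    (Ncount eps alpha beta != 0%N).
Proof.
rewrite cards_eq0; apply: (iffP (set0Pn _)) => -[x].
  by rewrite inE => /andP[/eqP ? /eqP ?]; exists x.
by case=> Mx xr; exists x; rewrite inE Mx xr !eqxx.
Qed.

Definition Nsupport : {set 'F_2 * 'F_2} :=
  [set q | Ncount eps q.1 q.2 != 0%N].

Lemma Nsupport_neq0 : Nsupport != set0.
Proof.
have [x Mx] := label_vec_solvable.
apply/set0Pn; exists (0, x r 0); rewrite inE; apply/Ncount_supportP.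
by exists x; rewrite scale0r addr0.
Qed.

Lemma Nsupport_affine : is_affine Nsupport.
Proof.
right; have [x0 Mx0] := label_vec_solvable.
pose V := ('cV['F_2]_#|T| * ('F_2)^o)%type.
pose c (z : V) : 'cV['F_2]_#|T| := M *m z.1 - z.2 *: e.
have cL : linear c.
  move=> a x y; rewrite /c /= mulmxDr -scalemxAr scalerBr scalerDl -scalerA.
  by rewrite opprD addrACA.
pose cM := GRing.isLinear.Build _ _ _ _ c cL.
pose cF : {linear _ -> _} := HB.pack c cM.
pose p (z : V) : ('F_2)^o * ('F_2)^o := (z.2, z.1 r 0).
have pL : linear p by move=> a x y; rewrite /p /= !mxE.
pose pM := GRing.isLinear.Build _ _ _ _ p pL.
pose pF : {linear _ -> _} := HB.pack p pM.
(* The base point is the root data of a solution [x0] for [alpha = 0]; the direction is the image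
   under [p] of the pairs [(z, a)] with [M z = a e]. *)
exists (0, x0 r 0), (linfun pF @: lker (linfun cF))%VS.
apply/setP=> -[alpha beta]; rewrite !inE; apply/Ncount_supportP/memv_imgP.
  move=> [x [Mx xr]]; exists (x - x0, alpha).
    rewrite memv_ker lfunE /= /c /= mulmxBr Mx Mx0.
    by rewrite [label_vec eps + _]addrC addrK subrr.
  by rewrite lfunE /= /p /= !mxE xr; congr (_, _); rewrite /= subr0.
move=> [[z a]]; rewrite memv_ker !lfunE /= /c /p /= subr_eq0 => /eqP Mz.
case; rewrite subr0 => -> zr; exists (z + x0); rewrite mulmxDr Mz Mx0 addrC; split=> //.
by rewrite mxE -zr subrK.
Qed.

Lemma Ncount_affine : exists k, forall alpha beta,
  Ncount eps alpha beta = (if (alpha, beta) \in Nsupport then 2 ^ k else 0)%N.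
Proof.
have [k Kk] := card_hom_sols; exists k => alpha beta; rewrite inE /=.
have [->//|/Ncount_supportP[x [Mx xr]]] := eqVneq.
by rewrite -Kk; apply: (@Ncount_translate _ _ x); rewrite inE Mx xr !eqxx.
Qed.

End AffineCount.

(** * Child subtrees as the components left after deleting the root *)

Section RootChildren.
Variable T : rootedTree.
Let r := tree_root T.

Definition offroot : rel T := fun x y => [&& adj x y, x != r & y != r].

Lemma offroot_path x p :
  x != r -> path offroot x p = path adj x p && (r \notin p).
Proof.
elim: p x => [|y p IH] x xr //=; rewrite /offroot xr inE negb_or [r == y]eq_sym /=.
case: eqP => [|/eqP yr]; first by rewrite !andbF.
by rewrite -/offroot IH //= andbT andbA.
Qed.

Lemma adj_root_neq c : adj r c -> c != r.
Proof. by apply: contraTneq => ->; rewrite adj_irr. Qed.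

(* Two distinct children joined by a path avoiding the root would close a
   cycle through the root. *)
Lemma offroot_connect_child c c' :
  adj r c -> adj r c' -> connect offroot c c' -> c = c'.
Proof.
move=> rc rc' /connectP[p pp c'E].
case/shortenP: pp c'E => q pq uq _ c'E; rewrite {}c'E in rc' *.
case: q pq uq rc' => // x q pq uq rc'.
have := pq; rewrite offroot_path ?adj_root_neq // => /andP[aq rq].
suff /adj_acyclic : ucycle adj (r :: c :: x :: q) by [].
apply/andP; split.
  change (adj r c && path adj c (rcons (x :: q) r)).
  by rewrite rc rcons_path aq adj_sym.
by rewrite cons_uniq uq inE negb_or rq andbT eq_sym adj_root_neq.
Qed.

(** A simple path from the root starts with some child [h] and never returns to the root. If it
    visits [c], then [h] and [c] are joined off the root, which forces [h = c]. *)
Lemma descendant_child c v : adj r c -> descendant c v = connect offroot c v.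
Proof.
move=> rc; apply/descendantP/idP => [[p []]|/connectP[p pp ->]].
  have cr := adj_root_neq rc.
  rewrite inE (negPf cr) /=; case: p => // h p /= /andP[rh ph] /andP[rhp _] <- chp.
  have op : path offroot h p.
    by rewrite offroot_path ?adj_root_neq // ph; move: rhp; rewrite inE negb_or => /andP[].
  have hc : connect offroot h c by apply: path_connect op _ chp.
  by rewrite -(offroot_connect_child rh rc hc); apply/connectP; exists p.
case/shortenP: pp => q pq uq _.
move: pq; rewrite offroot_path ?adj_root_neq // => /andP[aq rq].
exists (c :: q); split=> //; first by rewrite /= rc.
  by rewrite cons_uniq uq inE negb_or rq andbT eq_sym adj_root_neq.
by rewrite !inE eqxx orbT.
Qed.

Lemma descendant_child_inj c c' v :
  adj r c -> adj r c' -> descendant c v -> descendant c' v -> c = c'.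
Proof.
move=> rc rc'; rewrite !descendant_child // => cv c'v.
apply: offroot_connect_child => //; apply: connect_trans cv _.
rewrite (sym_connect_sym (e := offroot)) // => x y.
by rewrite /offroot adj_sym andbA andbAC -andbA.
Qed.

Lemma descendant_root c : adj r c -> descendant c r = false.
Proof.
move=> rc; rewrite descendant_child //; apply/connectP=> -[p pp rE].
move: pp; rewrite offroot_path ?adj_root_neq // => /andP[_].
have := mem_last c p; rewrite -rE inE eq_sym (negPf (adj_root_neq rc)) /=.
by move=> ->.
Qed.

Lemma ex_child_descendant v : v != r -> exists2 c, adj r c & descendant c v.
Proof.
move=> vr; have /connectP[p pp vE] := adj_connected r v.
case/shortenP: pp vE => -[|c q] pq uq _ vE; first by rewrite vE eqxx in vr.
exists c; first by case/andP: pq.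
by apply/descendantP; exists (c :: q); split=> //; rewrite !inE eqxx orbT.
Qed.

(** An edge leaving a child subtree can only lead to the root, since any other edge stays in the
    same component. *)
Lemma descendant_adj c v w : adj r c -> descendant c v -> adj v w ->
  descendant c w = (w != r).
Proof.
move=> rc dv vw; case: eqP => [->|/eqP wr]; first exact: descendant_root.
have vr : v != r by apply: contraTneq dv => ->; rewrite descendant_root.
move: dv; rewrite !descendant_child // => cv; apply: connect_trans cv _.
by apply: connect1; rewrite /offroot vw vr.
Qed.

Lemma descendant_adj_root c v : adj r c -> descendant c v -> adj v r = (v == c).
Proof.
move=> rc dv; apply/idP/eqP=> [|->]; last by rewrite adj_sym.
rewrite adj_sym => rv.
by apply: (descendant_child_inj rv rc (descendant_self v) dv).
Qed.

End RootChildren.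

(** * The linear system indexed by vertices *)

Section Systems.
Variables (T : rootedTree) (eps : T -> 'F_2).

Definition row_sum (x : T -> 'F_2) v := \sum_(w | adj v w) x w + eps v * x v.

(** With functions on vertices instead of column vectors, restriction to a subtree is composition
    with [val], and no enumerations have to be matched. *)
Definition sols (alpha beta : 'F_2) : {set {ffun T -> 'F_2}} :=
  [set x : {ffun T -> 'F_2} |
    [forall v, row_sum x v == eps v + alpha * (v == tree_root T)%:R]
    && (x (tree_root T) == beta)].

Lemma Ncount_sols alpha beta : Ncount eps alpha beta = #|sols alpha beta|.
Proof.
pose f (x : {ffun T -> 'F_2}) : 'cV['F_2]_#|T| := \col_i x (enum_val i).
have f_inj : injective f.
  move=> x y /matrixP fxy; apply/ffunP=> v.
  by have := fxy (enum_rank v) 0; rewrite !mxE enum_rankK.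
rewrite -(card_imset _ f_inj); apply: eq_card => y.
pose x : {ffun T -> 'F_2} := [ffun v => y (enum_rank v) 0].
have -> : y = f x.
  by apply/matrixP=> i j; rewrite !mxE ffunE enum_valK ord1.
rewrite mem_imset // !inE !mxE enum_rankK; congr (_ && _).
have rowE i : (tree_mx eps *m f x) i 0 = row_sum x (enum_val i).
  rewrite mulmxDl mul_diag_mx !mxE; congr (_ + _).
  rewrite [RHS]big_mkcond [RHS](reindex (@enum_val _ T)) /=; last first.
    by apply: onW_bij; exact: enum_val_bij.
  by apply: eq_bigr => j _; rewrite !mxE; case: ifP; rewrite (mul1r, mul0r).
apply/eqP/forallP=> [/matrixP fx v|fx].
  have := fx (enum_rank v) 0; rewrite rowE !mxE enum_rankK => ->.
  by rewrite eqxx andbT (inj_eq enum_rank_inj).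
apply/matrixP=> i j; rewrite ord1 rowE (eqP (fx _)) !mxE eqxx andbT.
by rewrite -(inj_eq enum_rank_inj) enum_valK.
Qed.

End Systems.

(** The only edge between the subtree and the rest of the tree joins [c] to the root, so the row of
    [c] alone gains a term, the value at the root. *)
Lemma row_sum_subtree (T : rootedTree) (eps x : T -> 'F_2) (c : T)
    (v : subtree c) : adj (tree_root T) c ->
  row_sum eps x (val v) = row_sum (restrict eps) (x \o val) v
    + x (tree_root T) * (v == tree_root (subtree c))%:R.
Proof.
move=> rc; rewrite /row_sum addrAC; congr (_ + _).
have dv : descendant c (val v) := valP v.
rewrite (bigID (descendant c)) /=; congr (_ + _).
  rewrite (eq_bigl (fun w => (w \in descendant c) && adj (val v) w)) => [|w]; last exact: andbC.
  by rewrite big_sub_cond.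
rewrite (eq_bigl (fun w => (v == tree_root (subtree c)) && (w == tree_root T))) => [|w].
  by case: eqP => _; rewrite ?mulr1 ?mulr0 ?big_pred1_eq ?big_pred0_eq.
have [vw|] := boolP (adj (val v) w) => /=.
  rewrite (descendant_adj rc dv vw) negbK; case: eqP vw => [->|]; last by rewrite andbF.
  by rewrite (descendant_adj_root rc dv) andbT => /esym ->.
case: (w =P _) => [->|_ _]; last by rewrite andbF.
rewrite (descendant_adj_root rc dv) andbT => vc.
by apply/esym/negbTE; apply: contraNneq vc => ->.
Qed.

(** * Splitting solutions along the child subtrees *)

Section Recursion.
Variables (T : rootedTree) (eps : T -> 'F_2) (m : nat) (r_ : 'I_m -> T).
Hypothesis r_inj : injective r_.
Hypothesis r_children : forall v : T, (v \in codom r_) = adj (tree_root T) v.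
Let r := tree_root T.

Lemma adj_child i : adj r (r_ i).
Proof. by rewrite -r_children codom_f. Qed.

Definition branch (x : T -> 'F_2) i : {ffun subtree (r_ i) -> 'F_2} :=
  [ffun v => x (val v)].

Lemma row_sum_branch x i (v : subtree (r_ i)) :
  row_sum eps x (val v) = row_sum (restrict eps) (branch x i) v
    + x r * (v == tree_root (subtree (r_ i)))%:R.
Proof.
rewrite (row_sum_subtree _ _ _ (adj_child i)); congr (_ + _).
by rewrite /row_sum ffunE; congr (_ + _); apply: eq_bigr => w _; rewrite ffunE.
Qed.

Lemma row_sum_root x : row_sum eps x r = \sum_i x (r_ i) + eps r * x r.
Proof.
congr (_ + _); rewrite -(big_imset (h := r_) (A := predT)) => [|i j _ _ /r_inj //].
apply: eq_bigl => v; rewrite -r_children.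
by apply/codomP/imsetP=> [[i ->]|[i _ ->]]; exists i.
Qed.

(** In characteristic 2 the root's contribution moves to the right-hand side of a child's system, so
    [beta] takes the place of [alpha] there, and the value at the child that of [beta]. *)
Lemma sols_branch alpha beta x :
  (x \in sols eps alpha beta) =
  [&& x r == beta, \sum_i x (r_ i) + eps r * beta == eps r + alpha
    & [forall i, branch x i \in sols (restrict eps) beta (x (r_ i))]].
Proof.
have addFF2_eq (a b c : 'F_2) : (a + b == c) = (a == c + b).
  by rewrite -{1}[b]addr0 -(inj_eq (addIr b)) -addrA addr0 addFF2 addr0.
rewrite inE andbC; case: eqP => //= <-.
have branch_eqs i : (branch x i \in sols (restrict eps) (x r) (x (r_ i))) =
    [forall v : subtree (r_ i), row_sum eps x (val v) == eps (val v)].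
  rewrite inE ffunE eqxx andbT; apply: eq_forallb => v.
  by rewrite row_sum_branch -addFF2_eq.
apply/forallP/andP=> [eqs|[eqr /forallP eqs] v].
  split; first by rewrite -row_sum_root (eqP (eqs r)) eqxx mulr1.
  apply/forallP=> i; rewrite branch_eqs; apply/forallP=> v.
  rewrite (eqP (eqs _)); case: (val v =P r) => [vr|]; last by rewrite mulr0 addr0.
  by have := valP v; rewrite /= vr descendant_root ?adj_child.
have [->|vr] := eqVneq v r; first by rewrite row_sum_root mulr1.
have [c rc cv] := ex_child_descendant vr.
move: rc; rewrite -r_children => /codomP[i cE]; rewrite {}cE in cv.
have := eqs i; rewrite branch_eqs => /forallP/(_ (Sub v cv)).
by rewrite /= mulr0 addr0.
Qed.

(** The vertex set is the disjoint union of the root and the branches, so [x] is freely assembled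
    from its root value and its branches. *)
Lemma card_branch_product (beta : 'F_2)
    (A : forall i, {set {ffun subtree (r_ i) -> 'F_2}}) :
  #|[set x : {ffun T -> 'F_2} | (x r == beta) && [forall i, branch x i \in A i]]|
  = (\prod_i #|A i|)%N.
Proof.
rewrite -cardsXn.
pose f (x : {ffun T -> 'F_2}) : {dffun forall i, {ffun subtree (r_ i) -> 'F_2}} :=
  [ffun i => branch x i].
have fE x i (v : subtree (r_ i)) : f x i v = x (val v) by rewrite !ffunE.
rewrite -(card_in_imset (f := f)) => [|x y].
  apply: eq_card => y; apply/imsetP/setXnP=> [[x + ->] i|Ay].
    by rewrite inE => /andP[_ /forallP/(_ i)]; rewrite ffunE.
  (* Gluing: a vertex other than the root lies in exactly one branch, so a single summand can be
     nonzero. *)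
  pose x : {ffun T -> 'F_2} := [ffun v => if v == r then beta else
    \sum_i if insub v is Some w then y i w else 0].
  have xE : y = f x.
    apply/ffunP=> i; apply/ffunP=> v; rewrite fE ffunE.
    have dv : descendant (r_ i) (val v) := valP v.
    case: eqP => [vr|_].
      by move: dv; rewrite vr descendant_root ?adj_child.
    rewrite (bigD1 i) //= valK big1 ?addr0 // => j ji.
    case: insubP => // w dj _; case/eqP: ji; apply: r_inj.
    exact: descendant_child_inj (adj_child j) (adj_child i) dj dv.
  exists x => //; rewrite inE ffunE !eqxx /=; apply/forallP=> i.
  by have := Ay i; rewrite xE ffunE.
rewrite !inE => /andP[/eqP xr _] /andP[/eqP yr _] fxy; apply/ffunP=> v.
have [->|vr] := eqVneq v r; first by rewrite xr yr.
have [c rc cv] := ex_child_descendant vr.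
move: rc; rewrite -r_children => /codomP[i cE]; rewrite {}cE in cv.
have fxyi : f x i (Sub v cv) = f y i (Sub v cv) by rewrite fxy.
by rewrite !fE in fxyi.
Qed.

(** Solutions are sorted by their values [g] at the children; once [g] is fixed, the branches are
    chosen independently. *)
Lemma Ncount_recursion alpha beta :
  Ncount eps alpha beta =
  (\sum_(g : {ffun 'I_m -> 'F_2} | (\sum_i g i + eps r * beta == eps r + alpha)%R)
     \prod_i Ncount (restrict (c := r_ i) eps) beta (g i))%N.
Proof.
rewrite Ncount_sols -sum1_card.
pose trace (x : {ffun T -> 'F_2}) := [ffun i => x (r_ i)].
rewrite (partition_big trace
  (fun g => \sum_i g i + eps r * beta == eps r + alpha)) => [|x]; last first.
  rewrite sols_branch => /and3P[_ + _]; congr (_ + _ == _).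
  by apply: eq_bigr => i _; rewrite ffunE.
apply: eq_bigr => g gE; rewrite sum1_card.
under [RHS]eq_bigr do rewrite Ncount_sols.
rewrite -(card_branch_product beta); apply: eq_card => x.
rewrite -[LHS]/((x \in sols eps alpha beta) && (trace x == g)) sols_branch inE.
apply/andP/andP=> [[/and3P[xr _ /forallP bx] /eqP <-]|[xr /forallP bx]].
  by split=> //; apply/forallP=> i; rewrite ffunE.
have gx i : g i = x (r_ i).
  by have := bx i; rewrite inE !ffunE => /andP[_ /eqP].
split; last by apply/eqP/ffunP=> i; rewrite ffunE gx.
apply/and3P; split=> //; last by apply/forallP=> i; rewrite -gx.
by under eq_bigr do rewrite -gx.
Qed.

Lemma Ncount_extensions (ks : 'I_m -> nat) (Ls : 'I_m -> {set 'F_2 * 'F_2})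
    alpha beta :
  (forall i (a b : 'F_2),
     Ncount (restrict (c := r_ i) eps) a b = (2 ^ ks i * ((a, b) \in Ls i))%N) ->
  Ncount eps alpha beta =
    (2 ^ (\sum_i ks i) * #|extensions Ls (eps r) alpha beta|)%N.
Proof.
move=> NE; rewrite Ncount_recursion -sum1_card big_distrr /= big_mkcond /=.
rewrite [RHS]big_mkcond /=; apply: eq_bigr => g _; rewrite inE andbC.
case: ifP => //= _; under eq_bigr do rewrite NE.
rewrite big_split /= -expn_sum; case: forallP => [gL|/forallP].
  by rewrite muln1 [X in (_ * X)%N]big1 ?muln1 // => i _; rewrite gL.
case/forallPn=> i /negPf gi.
by rewrite [X in (_ * X)%N](bigD1 i) //= gi mul0n muln0.
Qed.

End Recursion.

Theorem theorem1p4 (T : rootedTree) (eps : T -> 'F_2) :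
  exists (k : nat) (L : {set 'F_2 * 'F_2}),
    [/\ L != set0,
        is_affine L,
        forall alpha beta : 'F_2,
          Ncount eps alpha beta =
            (if (alpha, beta) \in L then 2 ^ k else 0)%N
      & forall (m : nat) (r_ : 'I_m -> T)
          (ks : 'I_m -> nat) (Ls : 'I_m -> {set 'F_2 * 'F_2}),
          injective r_ ->
          (forall v : T, (v \in codom r_) = adj (tree_root T) v) ->
          (forall i, is_affine (Ls i)) ->
          (forall i (alpha beta : 'F_2),
             Ncount (restrict (c := r_ i) eps) alpha beta =
               (2 ^ ks i * ((alpha, beta) \in Ls i))%N) ->
          (forall alpha beta : 'F_2,
             (alpha, beta) \in L <->
             exists g : {ffun 'I_m -> 'F_2},
               g \in extensions Ls (eps (tree_root T)) alpha beta)
          /\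
          exists s : nat,
            (forall alpha beta : 'F_2, (alpha, beta) \in L ->
               #|extensions Ls (eps (tree_root T)) alpha beta| = (2 ^ s)%N)
            /\ k = (\sum_(i < m) ks i + s)%N].
Proof.
have [k NE] := Ncount_affine eps.
exists k, (Nsupport eps); split=> //; first exact: Nsupport_neq0.
  exact: Nsupport_affine.
move=> m r_ ks Ls r_inj r_children _ LsE.
have ext := Ncount_extensions r_inj r_children _ _ LsE.
split=> [alpha beta|].
  rewrite inE /= ext muln_eq0 expn_eq0 /= cards_eq0.
  by split=> [/set0Pn//|g]; apply/set0Pn.
have ext_mul alpha beta : (alpha, beta) \in Nsupport eps ->
    (2 ^ k = 2 ^ (\sum_i ks i) *
       #|extensions Ls (eps (tree_root T)) alpha beta|)%N.
  by move=> Lab; rewrite -ext NE Lab.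
(* One point of the nonempty support suffices: there the power with exponent [\sum_i ks i] divides
   [2 ^ k]. Hence the truncated subtraction defining [s] below is exact. *)
have le_k : (\sum_i ks i <= k)%N.
  have /set0Pn[[alpha beta] /ext_mul kE] := Nsupport_neq0 eps.
  by rewrite -(@dvdn_Pexp2l 2) // kE dvdn_mulr.
exists (k - \sum_i ks i)%N; split=> [alpha beta /ext_mul kE|]; last by rewrite subnKC.
by apply/eqP; rewrite -(@eqn_pmul2l (2 ^ \sum_i ks i)) ?expn_gt0 // -kE -expnD subnKC.
Qed.
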